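(* Let $t\ge2$ and $\mu_B(t)\le u<1$, and assume $b^B_1(t,\omega(u))\ne0$, where $b^B_1(t,w)=(2t+1)w-t(t-4)$. Then $\mathfrak{e}^B_{t,u}\in\mathcal{E}(\mathcal{P}^+_{3,5})$ and $\mathfrak{e}^B_{t,u}(a^2,b^2,c^2)\in\mathcal{E}(\mathcal{P}_{3,10})$.
   Context: Let $a,b,c$ be variables. For nonnegative integers $m,n$ put $S_{m,n}=a^mb^n+b^mc^n+c^ma^n$, $S_n=S_{n,0}=a^n+b^n+c^n$, $T_{m,n}=S_{m,n}+S_{n,m}$, $U=abc$ (so $S_{1,1}=ab+bc+ca$). Put $s_0=S_5-US_{1,1}$, $s_1=T_{4,1}-2US_{1,1}$, $s_2=T_{3,2}-2US_{1,1}$, $s_3=US_2-US_{1,1}$, $s_4=US_{1,1}$. $\mathcal{P}^+_{3,5}$ is the cone of all real homogeneous quintic forms in $a,b,c$ nonnegative on $\mathbb{R}^3_{\ge0}$; $\mathcal{P}_{3,10}$ is the cone of real ternary forms of degree 10 nonnegative on $\mathbb{R}^3$. For a closed convex cone $\mathcal{P}$, $f\in\mathcal{P}\setminus\{0\}$ is extremal if $f=g+h$ with $g,h\in\mathcal{P}$ forces $g,h\in\mathbb{R}_{\ge0}f$; $\mathcal{E}(\mathcal{P})$ is the set of extremal elements. Auxiliary functions: $\mu_R(t)=2-t^2+t\sqrt{(t-1)(t+2)}$, $\mu_B(t)=\tfrac12\big(\mu_R(t)-\sqrt{\mu_R(t)^2-4}\big)$ (for $t\ge2$), $\omega(u)=u+\frac1u-2$.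 Family B: with $p^B_1(t,w)=-2w-3$, $p^B_2(t,w)=w^2+2w+2$, $p^B_3(t,w)=-\frac{2t^3+4t^2+5t+1}{t^2(t+2)}w^2+\frac{2(4t^2+5t+3)}{t+2}w-\frac{3t^3-7t^2-12t-8}{t+2}$, $p^B_4(t,w)=\frac{(t-1)^3(-w^2-2t^2w+t^2(t-2))}{t^2(t+2)}$, put $\mathfrak{e}^B_{t,u}=s_0+\sum_{i=1}^4p^B_i(t,\omega(u))s_i$. *)

(* Defs.v *)
From HB Require Import structures.
From mathcomp Require Import all_boot all_order all_algebra.
From mathcomp Require Import mpoly.
From mathcomp Require Import reals.
Set Implicit Arguments. Unset Strict Implicit. Unset Printing Implicit Defensive.
Import Order.TTheory GRing.Theory Num.Theory.
Local Open Scope ring_scope.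

Section Forms.
Variable R : realType.

Definition va : {mpoly R[3]} := 'X_(0 : 'I_3).
Definition vb : {mpoly R[3]} := 'X_(1 : 'I_3).
Definition vc : {mpoly R[3]} := 'X_(2 : 'I_3).

Definition Smn (m n : nat) : {mpoly R[3]} :=
  va ^+ m * vb ^+ n + vb ^+ m * vc ^+ n + vc ^+ m * va ^+ n.
Definition Sn (n : nat) : {mpoly R[3]} := Smn n 0.
Definition Tmn (m n : nat) : {mpoly R[3]} := Smn m n + Smn n m.
Definition U : {mpoly R[3]} := va * vb * vc.

Definition s0 : {mpoly R[3]} := Sn 5 - U * Smn 1 1.
Definition s1 : {mpoly R[3]} := Tmn 4 1 - 2%:R *: (U * Smn 1 1).
Definition s2 : {mpoly R[3]} := Tmn 3 2 - 2%:R *: (U * Smn 1 1).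
Definition s3 : {mpoly R[3]} := U * Sn 2 - U * Smn 1 1.
Definition s4 : {mpoly R[3]} := U * Smn 1 1.

Definition muR (t : R) : R := 2 - t ^+ 2 + t * Num.sqrt ((t - 1) * (t + 2)).
Definition muB (t : R) : R := (muR t - Num.sqrt (muR t ^+ 2 - 4)) / 2.
Definition omega (u : R) : R := u + u^-1 - 2.

Definition pB1 (t w : R) : R := - 2 * w - 3.
Definition pB2 (t w : R) : R := w ^+ 2 + 2 * w + 2.
Definition pB3 (t w : R) : R :=
  - ((2 * t ^+ 3 + 4 * t ^+ 2 + 5 * t + 1) / (t ^+ 2 * (t + 2))) * w ^+ 2
  + (2 * (4 * t ^+ 2 + 5 * t + 3) / (t + 2)) * w
  - (3 * t ^+ 3 - 7 * t ^+ 2 - 12 * t - 8) / (t + 2).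
Definition pB4 (t w : R) : R :=
  ((t - 1) ^+ 3 * (- w ^+ 2 - 2 * t ^+ 2 * w + t ^+ 2 * (t - 2))) / (t ^+ 2 * (t + 2)).
Definition bB1 (t w : R) : R := (2 * t + 1) * w - t * (t - 4).

Definition eB (t u : R) : {mpoly R[3]} :=
  let w := omega u in
  s0 + pB1 t w *: s1 + pB2 t w *: s2 + pB3 t w *: s3 + pB4 t w *: s4.

Definition Pplus35 (f : {mpoly R[3]}) : Prop :=
  f \is 5.-homog /\ forall x : 'I_3 -> R, (forall i, 0 <= x i) -> 0 <= f.@[x].

Definition P310 (f : {mpoly R[3]}) : Prop :=
  f \is 10.-homog /\ forall x : 'I_3 -> R, 0 <= f.@[x].

Definition extremal (P : {mpoly R[3]} -> Prop) (f : {mpoly R[3]}) : Prop :=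
  P f /\ f != 0 /\
  forall g h, P g -> P h -> f = g + h ->
    (exists2 l : R, 0 <= l & g = l *: f) /\ (exists2 l : R, 0 <= l & h = l *: f).

Definition sq_subst (f : {mpoly R[3]}) : {mpoly R[3]} :=
  f \mPo [tuple 'X_i ^+ 2 | i < 3].

End Forms.

(* Main.v *)
Require Import Defs.
From HB Require Import structures.
From mathcomp Require Import all_boot all_order all_algebra.
From mathcomp Require Import mpoly.
From mathcomp Require Import reals ring lra zify.
Import Order.TTheory GRing.Theory Num.Theory.
Local Open Scope ring_scope.
Set Implicit Arguments.
Unset Strict Implicit.

(** Write [F] for the form [eB t u] and [w = omega u].

    Nonnegativity.  In the elementary symmetric functions, [F] is affine in [xyz], with a
    nonnegative value at [xyz = 0]; hence it suffices to look at [F x y y] with [y <= x], where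
    there is an explicit factorization with a square.

    Zeros.  [F] vanishes at [(0, u, 1)], [(0, u^-1, 1)], [(t, 1, 1)] and their permutations.

    Extremality in degree 5.  If [0 <= g <= F] on the orthant, then [g] and its derivatives along
    the orthant vanish at these zeros.  The edge conditions leave three corner coefficients and six
    inner ones.  The nine conditions at [(t, 1, 1)], [(1, t, 1)], [(1, 1, t)] then split under the
    symmetric group: the non-symmetric part is killed as soon as
    [bB1 t w * (t ^ 2 + 4 t - w) <> 0], and the symmetric part is one-dimensional.

    Extremality in degree 10.  Split [g = g0 + yz g1 + xz g2 + xy g3] with [gi] forms in the
    squares.  Averaging over signs gives [0 <= g0 <= F], so [g0] is a multiple of [F], and
    [|yz g1| <= F], etc.  In the variables [x^2, y^2, z^2] this makes the quartic [g1] vanish at the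
    zeros of [F], to second order where [yz <> 0], which forces [g1 = 0]; likewise [g2 = g3 = 0]. *)

(** * Polynomials with sign conditions near 0 *)

(** Write [p = p.[0] + X q]. Since [q] is bounded on [[0, e]], a negative [p.[0]] would outweigh [s
    * q.[s]] for small [s]. *)
Lemma horner0_ge0 (R : realFieldType) (p : {poly R}) (e : R) :
  0 < e -> (forall s, 0 < s < e -> 0 <= p.[s]) -> 0 <= p.[0].
Proof.
move=> e0 pp; rewrite leNgt; apply/negP => p0.
have /factor_theorem [q pE] : root (p - p.[0]%:P) 0.
  by rewrite /root !hornerE subrr.
have {}pE s : p.[s] = p.[0] + q.[s] * s.
  have /(congr1 (fun r => r.[s])) := pE; rewrite !hornerE subr0 => <-.
  by rewrite addrC subrK.
have [M qM] := poly_itv_bound q 0 e.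
have M0 : 0 <= M by apply: le_trans (qM 0 _); rewrite ?normr_ge0 // lexx ltW.
(* Small enough that [s * M] is at most half of [- p.[0]]. *)
pose s := Num.min (e / 2) (- p.[0] / (2 * (M + 1))).
have s0 : 0 < s by rewrite lt_min !divr_gt0 ?oppr_gt0 //; lra.
have se : s < e by apply: (le_lt_trans (y := e / 2)); [rewrite ge_min lexx | lra].
have sM : s * (2 * (M + 1)) <= - p.[0].
  by rewrite -ler_pdivlMr; [rewrite ge_min lexx orbT | lra].
have := pp s; rewrite s0 se pE => /(_ isT).
have : q.[s] <= M by apply: le_trans (ler_norm _) (qM s _); rewrite !ltW.
by move=> qs; apply/negP; rewrite -ltNge; nra.
Qed.

(** With [p = X q] the derivative at 0 is [q.[0]], and [q] is nonnegative to the right of 0 and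
    nonpositive to the left. *)
Lemma local_min_deriv (R : realFieldType) (p : {poly R}) (e : R) :
  0 < e -> (forall s, `|s| < e -> 0 <= p.[s]) -> p.[0] = 0 -> p^`().[0] = 0.
Proof.
move=> e0 pp p0.
have /factor_theorem [q pE] : root p 0 by rewrite /root p0.
have -> : p^`().[0] = q.[0] by rewrite pE !derivE !hornerE oppr0 mulr0 add0r.
have : 0 <= (- (q \Po - 'X)).[0].
  apply: (@horner0_ge0 _ _ e) => // s /andP[s0 se].
  have := pp (- s); rewrite normrN gtr0_norm // => /(_ se).
  by rewrite pE !hornerE horner_comp !hornerE subr0 mulrN -mulNr pmulr_lge0.
rewrite !hornerE horner_comp !hornerE oppr0 oppr_ge0 => q0.
apply/eqP; rewrite eq_le q0 /=.
apply: (@horner0_ge0 _ _ e) => // s /andP[s0 se].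
by have := pp s; rewrite gtr0_norm // => /(_ se); rewrite pE !hornerE subr0 pmulr_lge0.
Qed.

(** Both [p - q] and [p + q] have a local minimum with value 0 at 0. *)
Lemma dominated_deriv (R : realFieldType) (p q : {poly R}) (e : R) :
  0 < e -> (forall s, `|s| < e -> `|q.[s]| <= p.[s]) -> p.[0] = 0 ->
  q.[0] = 0 /\ q^`().[0] = 0.
Proof.
move=> e0 qp p0.
have q0 : q.[0] = 0.
  by apply/eqP; rewrite -normr_le0; have := qp 0; rewrite normr0 p0; apply.
have dN : (p - q)^`().[0] = 0.
  apply: (@local_min_deriv _ _ e) => // [s /qp|]; last by rewrite !hornerE p0 q0 subrr.
  by rewrite !hornerE ler_norml subr_ge0 => /andP[].
have dP : (p + q)^`().[0] = 0.
  apply: (@local_min_deriv _ _ e) => // [s /qp|]; last by rewrite !hornerE p0 q0 addr0.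
  by rewrite !hornerE ler_norml => /andP[? _]; lra.
by split=> //; move: dN dP; rewrite !derivE !hornerE; lra.
Qed.

(** With [p = X r] the bound becomes [q ^ 2 <= s r ^ 2], whose right side tends to 0. It serves at
    zeros of [F] on the boundary where the factor [y * z] of [root_dominated] vanishes as well. *)
Lemma dominated_root (R : realFieldType) (p q : {poly R}) (e : R) :
  0 < e -> (forall s, 0 < s < e -> s * q.[s] ^+ 2 <= p.[s] ^+ 2) -> p.[0] = 0 ->
  q.[0] = 0.
Proof.
move=> e0 qp p0.
have /factor_theorem [r pE] : root p 0 by rewrite /root p0.
have : 0 <= ('X * r ^+ 2 - q ^+ 2).[0].
  apply: (@horner0_ge0 _ _ e) => // s /andP[s0 se].
  have := qp s; rewrite s0 se -(pmulr_rge0 _ s0) => /(_ isT).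
  have -> : p.[s] = r.[s] * s by rewrite pE !hornerE subr0.
  rewrite hornerD hornerN hornerM hornerX !horner_exp -subr_ge0.
  by congr (0 <= _); ring.
rewrite hornerD hornerN hornerM hornerX !horner_exp mul0r sub0r oppr_ge0 => q0.
by apply/eqP; rewrite -sqrf_eq0 eq_le q0 sqr_ge0.
Qed.

(** * Ternary forms by coefficients *)

Definition expos (d : nat) : seq (nat * nat * nat) :=
  [seq (i, j, (d - i - j)%N) | i <- iota 0 d.+1, j <- iota 0 (d - i).+1].

Lemma mem_expos d i j k : ((i, j, k) \in expos d) = (i + j + k == d)%N.
Proof.
apply/allpairsPdep/eqP => [[i' [j' []]]|<-].
  rewrite !mem_iota !add0n /= !ltnS => le_i le_j [-> -> ->].
  by rewrite -subnDA subnKC // -leq_subRL.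
exists i, j; rewrite !mem_iota /= !ltnS; split; last 1 first.
- by rewrite -addnA addKn addKn.
- by rewrite -addnA leq_addr.
- by rewrite -addnA addKn leq_addr.
Qed.

Lemma expos_uniq d : uniq (expos d).
Proof.
apply: allpairs_uniq_dep => [|i _|]; try exact: iota_uniq.
by move=> [i j] [i' j'] _ _ /= [-> ->].
Qed.

(** The general ring [A] lets one sum stand for values, for restrictions to a line and for
    multivariate polynomials. Only the values of [c] at exponents of sum [d] matter. *)
Definition tform (A : comNzRingType) d (c : nat -> nat -> nat -> A) (x y z : A) : A :=
  \sum_(m <- expos d) c m.1.1 m.1.2 m.2 * (x ^+ m.1.1 * y ^+ m.1.2 * z ^+ m.2).

(** The derivative of [tform d c] at [(x, y, z)] in the direction [(a, b, e)]. *)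
Definition dtform (A : comNzRingType) d (c : nat -> nat -> nat -> A) (x y z a b e : A) : A :=
  \sum_(m <- expos d) c m.1.1 m.1.2 m.2 *
    (a * (x ^+ m.1.1.-1 *+ m.1.1) * y ^+ m.1.2 * z ^+ m.2 +
     b * x ^+ m.1.1 * (y ^+ m.1.2.-1 *+ m.1.2) * z ^+ m.2 +
     e * x ^+ m.1.1 * y ^+ m.1.2 * (z ^+ m.2.-1 *+ m.2)).

Lemma tform_rmorph (A B : comNzRingType) (f : {rmorphism A -> B}) d c x y z :
  f (tform d c x y z) = tform d (fun i j k => f (c i j k)) (f x) (f y) (f z).
Proof.
by rewrite rmorph_sum; apply: eq_bigr => m _; rewrite !rmorphM !rmorphXn.
Qed.

Lemma tformZ (A : comNzRingType) d (l : A) c x y z :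
  tform d (fun i j k => l * c i j k) x y z = l * tform d c x y z.
Proof. by rewrite [RHS]mulr_sumr; apply: eq_bigr => m _; rewrite -mulrA. Qed.

Section Line.
Variables (R : comNzRingType) (d : nat) (c : nat -> nat -> nat -> R) (x y z a b e : R).

Definition tform_line : {poly R} :=
  tform d (fun i j k => (c i j k)%:P)
    (x%:P + a%:P * 'X) (y%:P + b%:P * 'X) (z%:P + e%:P * 'X).

Lemma horner_tform_line s :
  tform_line.[s] = tform d c (x + a * s) (y + b * s) (z + e * s).
Proof.
rewrite -[LHS]/(horner_eval s _) tform_rmorph /= /horner_eval !hornerE.
by apply: eq_bigr => m _; rewrite hornerC.
Qed.

Lemma deriv_tform_line : tform_line^`().[0] = dtform d c x y z a b e.
Proof.
rewrite /tform_line raddf_sum /= horner_sum; apply: eq_bigr => m _.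
by rewrite !derivE !deriv_exp !derivE !(hornerE, horner_exp, hornerMn); ring.
Qed.
End Line.

Lemma tform_crit (R : realFieldType) d c d' c' (x y z a b e r : R) :
  0 < r ->
  (forall s, `|s| < r -> `|tform d c (x + a * s) (y + b * s) (z + e * s)| <=
                         tform d' c' (x + a * s) (y + b * s) (z + e * s)) ->
  tform d' c' x y z = 0 ->
  tform d c x y z = 0 /\ dtform d c x y z a b e = 0.
Proof.
move=> r0 cc' F0.
have [] := @dominated_deriv _ (tform_line d' c' x y z a b e) (tform_line d c x y z a b e) r r0.
- by move=> s /cc'; rewrite !horner_tform_line.
- by rewrite horner_tform_line !mulr0 !addr0.
- by rewrite horner_tform_line deriv_tform_line !mulr0 !addr0.
Qed.

Lemma expos4 : expos 4 =
  [:: (0, 0, 4)%N; (0, 1, 3)%N; (0, 2, 2)%N; (0, 3, 1)%N; (0, 4, 0)%N; (1, 0, 3)%N;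
      (1, 1, 2)%N; (1, 2, 1)%N; (1, 3, 0)%N; (2, 0, 2)%N; (2, 1, 1)%N; (2, 2, 0)%N;
      (3, 0, 1)%N; (3, 1, 0)%N; (4, 0, 0)%N].
Proof. by []. Qed.

Lemma expos5 : expos 5 =
  [:: (0, 0, 5)%N; (0, 1, 4)%N; (0, 2, 3)%N; (0, 3, 2)%N; (0, 4, 1)%N; (0, 5, 0)%N;
      (1, 0, 4)%N; (1, 1, 3)%N; (1, 2, 2)%N; (1, 3, 1)%N; (1, 4, 0)%N; (2, 0, 3)%N;
      (2, 1, 2)%N; (2, 2, 1)%N; (2, 3, 0)%N; (3, 0, 2)%N; (3, 1, 1)%N; (3, 2, 0)%N;
      (4, 0, 1)%N; (4, 1, 0)%N; (5, 0, 0)%N].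
Proof. by []. Qed.

Definition tformE := (expos4, expos5, big_cons, big_nil).

(** * Nonnegativity *)

(** The values of [eB], with [w] freed from [u] so that the identities below are rational in [t] and
    [w]. *)
Definition B_value {R : realType} (t w x y z : R) : R :=
  let e1 := x + y + z in let e2 := x * y + y * z + z * x in let e3 := x * y * z in
  (x ^+ 5 + y ^+ 5 + z ^+ 5 - e3 * e2) +
  pB1 t w * (x ^+ 4 * (y + z) + y ^+ 4 * (x + z) + z ^+ 4 * (x + y) - 2 * (e3 * e2)) +
  pB2 t w * (x ^+ 3 * (y ^+ 2 + z ^+ 2) + y ^+ 3 * (x ^+ 2 + z ^+ 2)
             + z ^+ 3 * (x ^+ 2 + y ^+ 2) - 2 * (e3 * e2)) +
  pB3 t w * (e3 * (x ^+ 2 + y ^+ 2 + z ^+ 2) - e3 * e2) +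
  pB4 t w * (e3 * e2).

Lemma meval_eB (R : realType) (t u : R) (v : 'I_3 -> R) :
  (eB t u).@[v] = B_value t (omega u) (v 0) (v 1) (v 2).
Proof.
rewrite /eB /s0 /s1 /s2 /s3 /s4 /Sn /Tmn /Smn /U /va /vb /vc /B_value.
rewrite !(mevalD, mevalN, mevalZ, mevalM, rmorphXn) /= !mevalXU.
by ring.
Qed.

(** For [w = omega u] and [z = 1] the roots of the squared factor are [u] and [u^-1]: these are the
    zeros on the edge. *)
Lemma B_value_edge (R : realType) (t w y z : R) :
  B_value t w 0 y z = (y + z) * (y ^+ 2 + z ^+ 2 - (w + 2) * y * z) ^+ 2.
Proof. by rewrite /B_value /pB1 /pB2; ring. Qed.

(* A positive multiple of [pB4 t w] for [1 < t], hence of the value at [(1, 1, 1)]; the condition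
   [muB t <= u] amounts to its nonnegativity at [w = omega u]. *)
Definition B_slack {R : realType} (t w : R) : R :=
  t ^+ 2 * (t - 2) - 2 * t ^+ 2 * w - w ^+ 2.

(** The square accounts for the double zero at [(t, 1, 1)]. The cofactor is split so that both
    summands are nonnegative when [0 <= y <= x] and [0 <= B_slack t w]. *)
Lemma B_value_diag (R : realType) (t w x y : R) : 2 < t ->
  t ^+ 2 * (t + 2) * B_value t w x y y =
  (x - t * y) ^+ 2 * (x * y * B_slack t w * ((t - 7) * y + 2 * (t + 2) * x) +
    (t + 2) * (x - y) ^+ 2 * (2 * w ^+ 2 * y + t ^+ 2 * x)).
Proof.
move=> t2; have n1 : t != 0 by rewrite gt_eqF //; lra.
have n2 : t + 2 != 0 by rewrite gt_eqF //; lra.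
rewrite /B_value /pB1 /pB2 /pB3 /pB4 /B_slack; field.
by rewrite n1 n2.
Qed.

Lemma B_value_sym12 (R : realType) (t w x y z : R) : B_value t w x y z = B_value t w y x z.
Proof. by rewrite /B_value; ring. Qed.

Lemma B_value_sym23 (R : realType) (t w x y z : R) : B_value t w x y z = B_value t w x z y.
Proof. by rewrite /B_value; ring. Qed.

Lemma B_value_interior (R : realType) (t w : R) : 2 < t -> B_value t w t 1 1 = 0.
Proof.
move=> t2; have := @B_value_diag _ _ w t 1 t2; rewrite mulr1 subrr expr0n /= mul0r => /eqP.
rewrite mulf_eq0 => /orP[|/eqP //]; rewrite mulf_eq0 expf_eq0 /=.
by case/orP => /eqP ?; exfalso; lra.
Qed.

(** [t ^ 2 * (t - 2 - 2 w)] equals [B_slack t w + w ^ 2]. The bound later makes [t ^ 2 + 4 t - w]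
    and [t ^ 2 - t w - w] positive. *)
Lemma B_slack_w (R : realType) (t w : R) :
  2 < t -> 0 < w -> 0 <= B_slack t w -> 2 * w < t - 2.
Proof.
move=> t2 w0 V0; rewrite -subr_gt0 -(pmulr_rgt0 _ (x := t ^+ 2)); last by apply: exprn_gt0; lra.
by move: V0; rewrite /B_slack => V0; have : 0 < w ^+ 2; [exact: exprn_gt0 | lra].
Qed.

(* For given [a + b + c] and [ab + bc + ca], the largest [abc] is attained at a point [(x, y, y)]
   with [y <= x]. *)
Lemma B_value_ge0 (R : realType) (t w a b c : R) : 2 < t -> 0 <= B_slack t w ->
  0 <= a -> 0 <= b -> 0 <= c -> 0 <= B_value t w a b c.
Proof.
move=> t2 V0 a0 b0 c0.
pose p := a + b + c; pose q := a * b + b * c + c * a; pose r := a * b * c.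
(* The value is [A + r * B], where [A] and [B] depend on the point only through [p] and [q]. *)
pose A := p * (p ^+ 2 - (w + 4) * q) ^+ 2.
pose B := 5 * p ^+ 2 - 6 * q + pB1 t w * (3 * q - p ^+ 2) - pB2 t w * (2 * p ^+ 2 + 3 * q)
          + pB3 t w * (p ^+ 2 - 3 * q) + pB4 t w * q.
have -> : B_value t w a b c = A + r * B.
  by rewrite /B_value /A /B /pB1 /pB2 /r /q /p; ring.
have p0 : 0 <= p by rewrite !addr_ge0.
have q0 : 0 <= q by rewrite !addr_ge0 ?mulr_ge0.
have r0 : 0 <= r by rewrite !mulr_ge0.
have A0 : 0 <= A by rewrite mulr_ge0 // sqr_ge0.
have [B0|B0] := lerP 0 B; first by apply: addr_ge0 => //; exact: mulr_ge0.
(* Now [B < 0]: the value decreases in [r], so an upper bound for [r] at fixed [p] and [q] is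
   needed. *)
have pq : 0 <= p ^+ 2 - 3 * q.
  have -> : p ^+ 2 - 3 * q = ((a - b) ^+ 2 + (b - c) ^+ 2 + (c - a) ^+ 2) / 2.
    by rewrite /p /q; field.
  by rewrite divr_ge0 // !addr_ge0 ?sqr_ge0.
pose e := Num.sqrt (p ^+ 2 - 3 * q).
have eE : e ^+ 2 = p ^+ 2 - 3 * q by rewrite sqr_sqrtr.
have e0 : 0 <= e by rewrite sqrtr_ge0.
have ep : e <= p by rewrite -(ler_pXn2r (n := 2)) // ?nnegrE // eE; lra.
(* The solution of [x + 2 y = p], [2 x y + y ^ 2 = q] with [y <= x]. *)
pose y := (p - e) / 3; pose x := (p + 2 * e) / 3.
have qE : q = (p ^+ 2 - e ^+ 2) / 3 by lra.
have r_le : r <= x * y ^+ 2.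
  (* As a quadratic in [r], the discriminant of the cubic with roots [a], [b], [c] vanishes at
     [x * y ^ 2] and at the value obtained from it by [e -> - e], which is smaller by
     [4 / 27 * e ^ 3]. *)
  have : (r - x * y ^+ 2) * (r - x * y ^+ 2 + 4 / 27 * e ^+ 3) <= 0.
    have -> : (r - x * y ^+ 2) * (r - x * y ^+ 2 + 4 / 27 * e ^+ 3)
        = - ((a - b) * (b - c) * (c - a)) ^+ 2 / 27.
      (* After expansion only even powers of [e] remain, so [eE] eliminates the square root. *)
      have -> : (r - x * y ^+ 2) * (r - x * y ^+ 2 + 4 / 27 * e ^+ 3) =
        r ^+ 2 - r * (2 * p ^+ 3 - 6 * p * e ^+ 2) / 27 +
        (p ^+ 2 - 4 * e ^+ 2) * (p ^+ 2 - e ^+ 2) ^+ 2 / 729.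
        by rewrite /x /y; field.
      by rewrite eE /p /q /r; field.
    by have := sqr_ge0 ((a - b) * (b - c) * (c - a)); lra.
  have : 0 <= e ^+ 3 by rewrite exprn_ge0.
  by nra.
have diag : B_value t w x y y = A + x * y ^+ 2 * B.
  rewrite /B_value /A /B /pB1 /pB2 qE /x /y; by field.
have : 0 <= B_value t w x y y.
  have D0 : 0 < t ^+ 2 * (t + 2) by rewrite mulr_gt0 ?exprn_gt0 //; lra.
  rewrite -(pmulr_rge0 _ D0) B_value_diag // mulr_ge0 ?sqr_ge0 //.
  have y0 : 0 <= y by rewrite /y; lra.
  have xy : y <= x by rewrite /x /y; lra.
  have x0 : 0 <= x by lra.
  apply: addr_ge0; last first.
    have t0 : 0 <= t + 2 by lra.
    apply: mulr_ge0; first by apply: mulr_ge0 => //; exact: sqr_ge0.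
    have w2 : 0 <= 2 * w ^+ 2 by apply: mulr_ge0 => //; exact: sqr_ge0.
    by apply: addr_ge0; apply: mulr_ge0 => //; exact: sqr_ge0.
  apply: mulr_ge0; first by apply: mulr_ge0 => //; apply: mulr_ge0.
  (* For [y <= x] the factor [(t - 7) y + 2 (t + 2) x] is at least [3 (t - 1) y]. *)
  by nra.
by rewrite diag; nra.
Qed.

(** * Parameters and edge conditions *)

Lemma omega_edge (R : realType) (u : R) : u != 0 -> u ^+ 2 + 1 = (omega u + 2) * u.
Proof. by move=> u0; rewrite /omega; field. Qed.

Lemma omegaV (R : realType) (u : R) : omega u^-1 = omega u.
Proof. by rewrite /omega invrK [u^-1 + u]addrC. Qed.

(** With [M = muR t], the number [u] lies between the two roots of [s ^ 2 + 1 = M s], since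
    [u < 1 <= M / 2]. Hence [omega u + 2 <= M], which after isolating the square root and squaring
    is [0 <= B_slack t (omega u)]. *)
Lemma parameter_region (R : realType) (t u : R) :
  2 <= t -> muB t <= u -> u < 1 ->
  [/\ 2 < t, 0 < u, 0 < omega u & 0 <= B_slack t (omega u)].
Proof.
move=> t2 uB u1.
pose s := Num.sqrt ((t - 1) * (t + 2)); pose M := muR t; pose e := Num.sqrt (M ^+ 2 - 4).
have ME : M = 2 - t ^+ 2 + t * s by [].
have sE : s ^+ 2 = (t - 1) * (t + 2) by rewrite sqr_sqrtr //; apply: mulr_ge0; lra.
have s0 : 0 <= s by rewrite sqrtr_ge0.
have ts : t <= s.
  by rewrite -(ler_pXn2r (n := 2)) // ?nnegrE // ?sE; [nra | lra].
have M2 : 2 <= M by rewrite ME; nra.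
have eE : e ^+ 2 = M ^+ 2 - 4 by rewrite sqr_sqrtr //; nra.
have e0 : 0 <= e by rewrite sqrtr_ge0.
have eM : e < M by rewrite -(ltr_pXn2r (n := 2)) // ?nnegrE // ?eE; lra.
have uE : (M - e) / 2 <= u by exact: uB.
have u0 : 0 < u by lra.
have uM : u ^+ 2 + 1 <= M * u.
  have : (u - (M - e) / 2) * (u - (M + e) / 2) <= 0 by nra.
  by nra.
have u_neq0 : u != 0 by rewrite gt_eqF.
have wE := omega_edge u_neq0.
have w0 : 0 < omega u.
  rewrite -(pmulr_rgt0 _ u0).
  have -> : u * omega u = (1 - u) ^+ 2 by rewrite /omega; field.
  by apply: exprn_gt0; lra.
have wM : omega u + t ^+ 2 <= t * s.
  have : omega u + 2 <= M by rewrite -(ler_pM2r u0) -wE.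
  by rewrite ME; lra.
have V0 : 0 <= B_slack t (omega u).
  have : (omega u + t ^+ 2) ^+ 2 <= (t * s) ^+ 2.
    rewrite ler_pXn2r // ?nnegrE //; last by apply: mulr_ge0 => //; lra.
    by apply: addr_ge0; [exact: ltW | exact: sqr_ge0].
  by rewrite exprMn sE /B_slack; lra.
(* At [t = 2] the slack is [- 8 w - w ^ 2], negative for [w > 0]. *)
split=> //; rewrite lt_def t2 andbT; apply/eqP => tE.
by move: V0; rewrite /B_slack tE; nra.
Qed.

(** Two double roots exceed the degree. The identities eliminate the coefficients from the top and
    divide only by powers of [u - v]. *)
Lemma double_root_cubic (R : fieldType) (u v a0 a1 a2 a3 : R) : u != v ->
  a0 + a1 * u + a2 * u ^+ 2 + a3 * u ^+ 3 = 0 -> a1 + 2 * a2 * u + 3 * a3 * u ^+ 2 = 0 ->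
  a0 + a1 * v + a2 * v ^+ 2 + a3 * v ^+ 3 = 0 -> a1 + 2 * a2 * v + 3 * a3 * v ^+ 2 = 0 ->
  [/\ a0 = 0, a1 = 0, a2 = 0 & a3 = 0].
Proof.
rewrite -subr_eq0 => uv pu du pv dv.
have a3_0 : a3 = 0.
  have : a3 * (u - v) ^+ 3 = 0.
    transitivity ((u - v) * (a1 + 2 * a2 * u + 3 * a3 * u ^+ 2) +
      (u - v) * (a1 + 2 * a2 * v + 3 * a3 * v ^+ 2) -
      2 * ((a0 + a1 * u + a2 * u ^+ 2 + a3 * u ^+ 3) -
           (a0 + a1 * v + a2 * v ^+ 2 + a3 * v ^+ 3))); first by ring.
    by rewrite pu du pv dv; ring.
  by move/eqP; rewrite mulf_eq0 expf_eq0 (negbTE uv) orbF => /eqP.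
subst a3.
have a2_0 : a2 = 0.
  have : a2 * (u - v) ^+ 2 = 0.
    transitivity ((a1 + 2 * a2 * u + 3 * 0 * u ^+ 2) * (u - v) -
      ((a0 + a1 * u + a2 * u ^+ 2 + 0 * u ^+ 3) -
           (a0 + a1 * v + a2 * v ^+ 2 + 0 * v ^+ 3))); first by ring.
    by rewrite pu du pv; ring.
  by move/eqP; rewrite mulf_eq0 expf_eq0 (negbTE uv) orbF => /eqP.
subst a2.
have a1_0 : a1 = 0 by rewrite -du; ring.
by subst a1; split=> //; rewrite -pu; ring.
Qed.

(** The conclusion says [p = (a0 + a5 s) (s ^ 2 - k s + 1) ^ 2]. The difference of the two sides is
    [s] times a cubic with double roots at [u] and [v]. *)
Lemma binary_quintic (R : fieldType) (k u v a0 a1 a2 a3 a4 a5 : R) :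
  u != v -> u != 0 -> v != 0 -> u ^+ 2 + 1 = k * u -> v ^+ 2 + 1 = k * v ->
  let p s := a0 + a1 * s + a2 * s ^+ 2 + a3 * s ^+ 3 + a4 * s ^+ 4 + a5 * s ^+ 5 in
  let dp s := a1 + 2 * a2 * s + 3 * a3 * s ^+ 2 + 4 * a4 * s ^+ 3 + 5 * a5 * s ^+ 4 in
  p u = 0 -> dp u = 0 -> p v = 0 -> dp v = 0 ->
  [/\ a1 = a5 - 2 * k * a0, a2 = (k ^+ 2 + 2) * a0 - 2 * k * a5,
      a3 = (k ^+ 2 + 2) * a5 - 2 * k * a0 & a4 = a0 - 2 * k * a5].
Proof.
move=> uv u0 v0 uk vk p dp.
pose b1 := a1 - (a5 - 2 * k * a0); pose b2 := a2 - ((k ^+ 2 + 2) * a0 - 2 * k * a5).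
pose b3 := a3 - ((k ^+ 2 + 2) * a5 - 2 * k * a0); pose b4 := a4 - (a0 - 2 * k * a5).
have red s : s != 0 -> s ^+ 2 + 1 = k * s -> p s = 0 -> dp s = 0 ->
    b1 + b2 * s + b3 * s ^+ 2 + b4 * s ^+ 3 = 0 /\ b2 + 2 * b3 * s + 3 * b4 * s ^+ 2 = 0.
  move=> s0 sk ps dps.
  have Q0 : s ^+ 2 + 1 - k * s = 0 by rewrite sk subrr.
  have e0 : b1 + b2 * s + b3 * s ^+ 2 + b4 * s ^+ 3 = 0.
    apply: (mulfI s0); rewrite mulr0.
    transitivity (p s - (a0 + a5 * s) * (s ^+ 2 + 1 - k * s) ^+ 2).
      by rewrite /p /b1 /b2 /b3 /b4; ring.
    by rewrite ps Q0; ring.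
  split=> //; apply: (mulfI s0); rewrite mulr0.
  transitivity (dp s - a5 * (s ^+ 2 + 1 - k * s) ^+ 2
     - (a0 + a5 * s) * 2 * (s ^+ 2 + 1 - k * s) * (2 * s - k)
     - (b1 + b2 * s + b3 * s ^+ 2 + b4 * s ^+ 3)).
    by rewrite /dp /b1 /b2 /b3 /b4; ring.
  by rewrite dps Q0 e0; ring.
move=> pu du pv dv.
have [pu' du'] := red u u0 uk pu du; have [pv' dv'] := red v v0 vk pv dv.
have [b1_0 b2_0 b3_0 b4_0] := @double_root_cubic _ _ _ _ _ _ _ uv pu' du' pv' dv'.
by split; apply/eqP; rewrite -subr_eq0; apply/eqP.
Qed.

(** Simple roots only: [p = (a0 + (a3 + k a4) s + a4 s ^ 2) (s ^ 2 - k s + 1)], where the difference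
    is [s] times a linear polynomial. *)
Lemma binary_quartic (R : fieldType) (k u v a0 a1 a2 a3 a4 : R) :
  u != v -> u != 0 -> v != 0 -> u ^+ 2 + 1 = k * u -> v ^+ 2 + 1 = k * v ->
  let p s := a0 + a1 * s + a2 * s ^+ 2 + a3 * s ^+ 3 + a4 * s ^+ 4 in
  p u = 0 -> p v = 0 ->
  a2 = a4 + a0 - k * (a3 + k * a4) /\ a1 = (a3 + k * a4) - k * a0.
Proof.
move=> uv u0 v0 uk vk p.
pose b1 := a1 - ((a3 + k * a4) - k * a0); pose b2 := a2 - (a4 + a0 - k * (a3 + k * a4)).
have red s : s != 0 -> s ^+ 2 + 1 = k * s -> p s = 0 -> b1 + b2 * s = 0.
  move=> s0 sk ps.
  have Q0 : s ^+ 2 + 1 - k * s = 0 by rewrite sk subrr.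
  apply: (mulfI s0); rewrite mulr0.
  transitivity (p s - (a0 + (a3 + k * a4) * s + a4 * s ^+ 2) * (s ^+ 2 + 1 - k * s)).
    by rewrite /p /b1 /b2; ring.
  by rewrite ps Q0; ring.
move=> /(red u u0 uk) pu /(red v v0 vk) pv.
have b2_0 : b2 = 0.
  have : b2 * (u - v) = 0 by transitivity ((b1 + b2 * u) - (b1 + b2 * v));
    [ring | rewrite pu pv subrr].
  by move/eqP; rewrite mulf_eq0 (subr_eq0 u) (negbTE uv) orbF => /eqP.
have b1_0 : b1 = 0 by rewrite -pu b2_0; ring.
by split; apply/eqP; rewrite -subr_eq0; apply/eqP.
Qed.

(** * Forms dominated by [F] *)

Section Uniqueness.
Variables (R : realType) (t w u v : R) (cB : nat -> nat -> nat -> R).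
Hypotheses (t2 : 2 < t) (w0 : 0 < w) (V0 : 0 <= B_slack t w)
  (b1_neq0 : bB1 t w != 0) (u0 : 0 < u) (v0 : 0 < v) (uv : u != v)
  (uw : u ^+ 2 + 1 = (w + 2) * u) (vw : v ^+ 2 + 1 = (w + 2) * v)
  (cBE : forall x y z, tform 5 cB x y z = B_value t w x y z).
Local Notation F := (B_value t w).

Lemma B_crit d c (L r x y z a b e : R) : 0 < r -> F x y z = 0 ->
  (forall s, - r < s -> s < r -> `|tform d c (x + a * s) (y + b * s) (z + e * s)| <=
     L * F (x + a * s) (y + b * s) (z + e * s)) ->
  tform d c x y z = 0 /\ dtform d c x y z a b e = 0.
Proof.
move=> r0 F0 cF.
apply: (@tform_crit _ _ _ 5 (fun i j k => L * cB i j k) _ _ _ _ _ _ r) => // [s|].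
  by rewrite ltr_norml => /andP[? ?]; rewrite tformZ cBE; apply: cF.
by rewrite tformZ cBE F0 mulr0.
Qed.

Lemma B_zero_edge s : s ^+ 2 + 1 = (w + 2) * s -> F 0 s 1 = 0.
Proof. by move=> sw; rewrite B_value_edge mulr1 expr1n sw subrr expr0n mulr0. Qed.

(** The absolute value and the constant [L] make the condition stable under subtracting multiples of
    [F]. *)
Definition B_dominated (c : nat -> nat -> nat -> R) : Prop :=
  exists L, forall x y z, 0 <= x -> 0 <= y -> 0 <= z ->
    `|tform 5 c x y z| <= L * F x y z.

Lemma dominated_crit c x y z a b e r : B_dominated c -> 0 < r -> F x y z = 0 ->
  (forall s, - r < s -> s < r -> [/\ 0 <= x + a * s, 0 <= y + b * s & 0 <= z + e * s]) ->
  tform 5 c x y z = 0 /\ dtform 5 c x y z a b e = 0.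
Proof.
move=> [L cF] r0 F0 pos; apply: (@B_crit _ _ L r) => // s s1 s2.
by have [? ? ?] := pos s s1 s2; exact: cF.
Qed.

Lemma dominated_perm12 c : B_dominated c -> B_dominated (fun i j k => c j i k).
Proof.
move=> [L cF]; exists L => x y z x0 y0 z0; rewrite B_value_sym12.
have -> : tform 5 (fun i j k => c j i k) x y z = tform 5 c y x z.
  by rewrite /tform !tformE /=; ring.
exact: cF.
Qed.

Lemma dominated_perm23 c : B_dominated c -> B_dominated (fun i j k => c i k j).
Proof.
move=> [L cF]; exists L => x y z x0 y0 z0; rewrite B_value_sym23.
have -> : tform 5 (fun i j k => c i k j) x y z = tform 5 c x z y.
  by rewrite /tform !tformE /=; ring.
exact: cF.
Qed.

Lemma dominated_edge c : B_dominated c ->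
  [/\ c 0%N 1%N 4%N = c 0%N 5%N 0%N - 2 * (w + 2) * c 0%N 0%N 5%N,
      c 0%N 2%N 3%N = ((w + 2) ^+ 2 + 2) * c 0%N 0%N 5%N - 2 * (w + 2) * c 0%N 5%N 0%N,
      c 0%N 3%N 2%N = ((w + 2) ^+ 2 + 2) * c 0%N 5%N 0%N - 2 * (w + 2) * c 0%N 0%N 5%N &
      c 0%N 4%N 1%N = c 0%N 0%N 5%N - 2 * (w + 2) * c 0%N 5%N 0%N].
Proof.
move=> cF.
have crit s : 0 < s -> s ^+ 2 + 1 = (w + 2) * s ->
    tform 5 c 0 s 1 = 0 /\ dtform 5 c 0 s 1 0 1 0 = 0.
  move=> s0 sw; apply: (dominated_crit cF s0 (B_zero_edge sw)) => h h1 h2.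
  by split; lra.
have [] := crit u u0 uw; have [] := crit v v0 vw.
rewrite /tform /dtform !tformE /= => pv dv pu du.
apply: (binary_quintic uv) => //; rewrite ?gt_eqF //.
- by rewrite -[RHS]pu; ring.
- by rewrite -[RHS]du; ring.
- by rewrite -[RHS]pv; ring.
- by rewrite -[RHS]dv; ring.
Qed.

Lemma dominated_edges c : B_dominated c ->
  let k := w + 2 in
  let edge a0 a1 a2 a3 a4 a5 :=
    [/\ a1 = a5 - 2 * k * a0, a2 = (k ^+ 2 + 2) * a0 - 2 * k * a5,
        a3 = (k ^+ 2 + 2) * a5 - 2 * k * a0 & a4 = a0 - 2 * k * a5] in
  [/\ edge (c 0%N 0%N 5%N) (c 0%N 1%N 4%N) (c 0%N 2%N 3%N)
        (c 0%N 3%N 2%N) (c 0%N 4%N 1%N) (c 0%N 5%N 0%N),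
      edge (c 0%N 0%N 5%N) (c 1%N 0%N 4%N) (c 2%N 0%N 3%N)
        (c 3%N 0%N 2%N) (c 4%N 0%N 1%N) (c 5%N 0%N 0%N) &
      edge (c 0%N 5%N 0%N) (c 1%N 4%N 0%N) (c 2%N 3%N 0%N)
        (c 3%N 2%N 0%N) (c 4%N 1%N 0%N) (c 5%N 0%N 0%N)].
Proof.
move=> cF k edge; split; first exact: dominated_edge cF.
  exact: (dominated_edge (dominated_perm12 cF)).
exact: (dominated_edge (dominated_perm12 (dominated_perm23 cF))).
Qed.

Lemma dominated_interior c x y z a b e : B_dominated c -> F x y z = 0 ->
  1 <= x -> 1 <= y -> 1 <= z -> -1 <= a <= 1 -> -1 <= b <= 1 -> -1 <= e <= 1 ->
  tform 5 c x y z = 0 /\ dtform 5 c x y z a b e = 0.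
Proof.
move=> cF F0 x1 y1 z1 /andP[? ?] /andP[? ?] /andP[? ?].
apply: (dominated_crit cF ltr01 F0) => s s1 s2; split; nra.
Qed.

Lemma B_zero1 : F t 1 1 = 0. Proof. exact: B_value_interior. Qed.
Lemma B_zero2 : F 1 t 1 = 0. Proof. by rewrite B_value_sym12 B_zero1. Qed.
Lemma B_zero3 : F 1 1 t = 0. Proof. by rewrite B_value_sym23 B_zero2. Qed.

(** Both factors return in the elimination of a corner difference for quintics and of [c 0 0 4] for
    quartics. *)
Lemma det_neq0 : bB1 t w * (t ^+ 2 + 4 * t - w) != 0.
Proof.
apply: mulf_neq0 => //; rewrite gt_eqF //.
by have := B_slack_w t2 w0 V0; have := t2; have := w0; nra.
Qed.

(* The multipliers of the critical point equations in the proof are cofactors of the linear system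
   satisfied by the antisymmetric parts [c 0 5 0 - c 0 0 5], [c 1 3 1 - c 1 1 3],
   [c 2 1 2 - c 2 2 1]. *)
Lemma dominated_swap23 c : B_dominated c ->
  [/\ c 0%N 5%N 0%N = c 0%N 0%N 5%N, c 1%N 3%N 1%N = c 1%N 1%N 3%N & c 2%N 1%N 2%N = c 2%N 2%N 1%N].
Proof.
move=> cF; have t2' := t2.
have [[e1 e2 e3 e4] [f1 f2 f3 f4] [g1 g2 g3 g4]] := dominated_edges cF.
pose ee := (e1, e2, e3, e4, (f1, f2, f3, f4), (g1, g2, g3, g4)).
have i01 : -1 <= (0 : R) <= 1 by lra.
have i11 : -1 <= (1 : R) <= 1 by lra.
have i1N : -1 <= (-1 : R) <= 1 by lra.
have t1 : 1 <= t by lra.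
(* Only combinations odd under the swap of [y] and [z] are used: the direction [(0, 1, -1)] at
   [(t, 1, 1)], and differences between [(1, t, 1)] and [(1, 1, t)]. *)
have [_ ha] := dominated_interior cF B_zero1 t1 (lexx 1) (lexx 1) i01 i11 i1N.
have [hb hb'] := dominated_interior cF B_zero2 (lexx 1) t1 (lexx 1) i01 i11 i01.
have [hc hc'] := dominated_interior cF B_zero3 (lexx 1) (lexx 1) t1 i01 i01 i11.
have B0 : c 0%N 5%N 0%N - c 0%N 0%N 5%N = 0.
  have : (t - 1) ^+ 3 * (bB1 t w * (t ^+ 2 + 4 * t - w)) * (c 0%N 5%N 0%N - c 0%N 0%N 5%N) = 0.
    transitivity (- (t * (t - 1) * dtform 5 c t 1 1 0 1 (-1)
      + (2 - 3 * t - 3 * t ^+ 2) * (tform 5 c 1 t 1 - tform 5 c 1 1 t)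
      + t * (t - 1) * (t + 2) * (dtform 5 c 1 t 1 0 1 0 - dtform 5 c 1 1 t 0 0 1)) / 2).
      by rewrite /dtform /tform !tformE /= !ee /bB1; field.
    by rewrite ha hb hb' hc hc'; ring.
  move/eqP; rewrite mulf_eq0 mulf_eq0 expf_eq0 (negbTE det_neq0) orbF => /orP[|/eqP//].
  by rewrite subr_eq0 gt_eqF //; lra.
have B1 : c 0%N 5%N 0%N = c 0%N 0%N 5%N by apply/eqP; rewrite -subr_eq0 B0.
have K1 : c 1%N 3%N 1%N = c 1%N 1%N 3%N.
  have : (t * (t - 1) ^+ 2 * (t + 2)) * (c 1%N 3%N 1%N - c 1%N 1%N 3%N) = 0.
    transitivity (t * (tform 5 c 1 t 1 - tform 5 c 1 1 t)
        - (t - 1) * dtform 5 c t 1 1 0 1 (-1)).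
      by rewrite /dtform /tform !tformE /= !ee !B1; ring.
    by rewrite ha hb hc; ring.
  move/eqP; rewrite mulf_eq0 subr_eq0 => /orP[|/eqP//].
  by rewrite gt_eqF // mulr_gt0 ?mulr_gt0 ?exprn_gt0 //; lra.
split=> //; apply/eqP; rewrite -subr_eq0; apply/eqP.
have : t ^+ 2 * (c 2%N 1%N 2%N - c 2%N 2%N 1%N) = 0.
  transitivity (- dtform 5 c t 1 1 0 1 (-1)); last by rewrite ha oppr0.
  by rewrite /dtform !tformE /= !ee !B1 !K1; ring.
by move/eqP; rewrite mulf_eq0 expf_eq0 /= => /orP[/eqP ?|/eqP//]; lra.
Qed.

(** [dominated_swap23] and its cyclic conjugate make the coefficients symmetric. With zero corners,
    only [c 3 1 1] and [c 1 2 2] remain, and the value and the [x]-derivative at [(t, 1, 1)] give a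
    system with determinant [- 2 t ^ 2 (t - 1) (t + 2)]. *)
Lemma dominated_eq0 c : B_dominated c -> c 5%N 0%N 0%N = 0 ->
  forall i j k, (i + j + k = 5)%N -> c i j k = 0.
Proof.
move=> cF A0; have t2' := t2.
have [B1 K1 R1] := dominated_swap23 cF.
have [/= B2 K2 R2] := dominated_swap23 (dominated_perm23 (dominated_perm12 cF)).
have [[e1 e2 e3 e4] [f1 f2 f3 f4] [g1 g2 g3 g4]] := dominated_edges cF.
pose ee := (e1, e2, e3, e4, (f1, f2, f3, f4), (g1, g2, g3, g4)).
have i01 : -1 <= (0 : R) <= 1 by lra.
have i11 : -1 <= (1 : R) <= 1 by lra.
have t1 : 1 <= t by lra.
have [ha ha'] := dominated_interior cF B_zero1 t1 (lexx 1) (lexx 1) i11 i01 i01.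
have q0 : c 3%N 1%N 1%N = 0.
  have : 2 * t ^+ 2 * (t - 1) * (t + 2) * c 3%N 1%N 1%N = 0.
    transitivity ((2 * t ^+ 2 + t) * dtform 5 c t 1 1 1 0 0 - (4 * t + 1) * tform 5 c t 1 1).
      by rewrite /dtform /tform !tformE /= !ee B1 K1 R1 B2 K2 R2 A0; ring.
    by rewrite ha ha'; ring.
  move/eqP; rewrite mulf_eq0 => /orP[|/eqP//].
  by rewrite gt_eqF // mulr_gt0 ?mulr_gt0 ?exprn_gt0 //; lra.
have r0 : c 1%N 2%N 2%N = 0.
  have : (4 * t + 1) * c 1%N 2%N 2%N = 0.
    rewrite -[RHS]ha' /dtform !tformE /= !ee B1 K1 R1 B2 K2 R2 A0 q0; ring.
  by move/eqP; rewrite mulf_eq0 => /orP[|/eqP//]; rewrite gt_eqF //; lra.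
move=> i j k ijk; have : (i, j, k) \in expos 5 by rewrite mem_expos ijk.
rewrite expos5 !inE.
do ?[case/orP]; move=> /eqP[-> -> ->];
  by rewrite ?ee ?(B1, K1, R1) ?(B2, K2, R2) ?A0 ?q0 ?r0 ?mulr0 ?subr0.
Qed.
(* The square of [|bc K(a^2, b^2, c^2)| <= F(a^2, b^2, c^2)] in the variables [x = a^2], [y = b^2],
   [z = c^2]. *)
Definition root_dominated (c : nat -> nat -> nat -> R) : Prop :=
  forall x y z, 0 <= x -> 0 <= y -> 0 <= z ->
    y * z * tform 4 c x y z ^+ 2 <= F x y z ^+ 2.

Lemma root_dominated_perm23 c : root_dominated c -> root_dominated (fun i j k => c i k j).
Proof.
move=> cF x y z x0 y0 z0; rewrite B_value_sym23 [y * z]mulrC.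
have -> : tform 4 (fun i j k => c i k j) x y z = tform 4 c x z y.
  by rewrite /tform !tformE /=; ring.
exact: cF.
Qed.

(** Away from [y * z = 0] one may take square roots; [m^-1 + 1] is a root-free upper bound for the
    square root of [m^-1]. *)
Lemma root_dominated_norm c (m x y z : R) : root_dominated c -> 0 < m ->
  0 <= x -> 0 <= y -> 0 <= z -> m <= y * z ->
  `|tform 4 c x y z| <= (m^-1 + 1) * F x y z.
Proof.
move=> cF m0 x0 y0 z0 myz; have F0 : 0 <= F x y z by apply: B_value_ge0.
have i0 : 0 < m^-1 by rewrite invr_gt0.
have le0 : 0 <= (m^-1 + 1) * F x y z by apply: mulr_ge0 => //; lra.
rewrite -(ler_pXn2r (n := 2)) // ?nnegrE // real_normK ?num_real //.
have le1 : m * tform 4 c x y z ^+ 2 <= F x y z ^+ 2.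
  by apply: le_trans (cF _ _ _ x0 y0 z0); apply: ler_wpM2r => //; exact: sqr_ge0.
have : tform 4 c x y z ^+ 2 <= m^-1 * F x y z ^+ 2 by rewrite ler_pdivlMl.
have : 0 <= F x y z ^+ 2 by exact: sqr_ge0.
rewrite exprMn; move: (F x y z ^+ 2) (tform 4 c x y z ^+ 2) (m^-1) i0 => f g i i0 f0 gf.
by apply: le_trans gf _; apply: ler_wpM2r => //; nra.
Qed.

Lemma root_dominated_interior c x y z a b e : root_dominated c -> F x y z = 0 ->
  1 <= x -> 1 <= y -> 1 <= z -> -1 <= a <= 1 -> -1 <= b <= 1 -> -1 <= e <= 1 ->
  tform 4 c x y z = 0 /\ dtform 4 c x y z a b e = 0.
Proof.
move=> cF F0 x1 y1 z1 /andP[? ?] /andP[? ?] /andP[? ?].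
(* For [s] below [1 / 2] in absolute value the coordinates stay above [1 / 2], so [y * z] is at
   least [1 / 4]. *)
have h0 : 0 < (1 / 2 : R) by lra.
have q0 : 0 < (1 / 4 : R) by lra.
apply: (B_crit (L := (1 / 4)^-1 + 1) h0 F0) => s s1 s2.
have hx : 1 / 2 <= x + a * s by nra.
have hy : 1 / 2 <= y + b * s by nra.
have hz : 1 / 2 <= z + e * s by nra.
by apply: root_dominated_norm => //; nra.
Qed.

(** On [x = 0] the factor [y * z] is nonzero at the zeros of [F], so they are double zeros. The
    quartic is treated as a quintic with leading coefficient 0. *)
Lemma root_dominated_edge c : root_dominated c -> let k := w + 2 in
  [/\ c 0%N 1%N 3%N = - 2 * k * c 0%N 0%N 4%N, c 0%N 2%N 2%N = (k ^+ 2 + 2) * c 0%N 0%N 4%N,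
      c 0%N 3%N 1%N = - 2 * k * c 0%N 0%N 4%N & c 0%N 4%N 0%N = c 0%N 0%N 4%N].
Proof.
move=> cF k.
have crit s : 0 < s -> s ^+ 2 + 1 = (w + 2) * s ->
    tform 4 c 0 s 1 = 0 /\ dtform 4 c 0 s 1 0 1 0 = 0.
  move=> s0 sw; have h0 : 0 < s / 2 by lra.
  apply: (B_crit (L := (s / 2)^-1 + 1) h0 (B_zero_edge sw)) => h h1 h2.
  by apply: root_dominated_norm => //; lra.
have [] := crit u u0 uw; have [] := crit v v0 vw.
rewrite /tform /dtform !tformE /= => pv dv pu du.
have [] := @binary_quintic _ k u v (c 0%N 0%N 4%N) (c 0%N 1%N 3%N) (c 0%N 2%N 2%N)
  (c 0%N 3%N 1%N) (c 0%N 4%N 0%N) 0 uv.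
- by rewrite gt_eqF.
- by rewrite gt_eqF.
- exact: uw.
- exact: vw.
- by rewrite -[RHS]pu; ring.
- by rewrite -[RHS]du; ring.
- by rewrite -[RHS]pv; ring.
- by rewrite -[RHS]dv; ring.
by move=> -> -> -> ->; split; ring.
Qed.

(** On [y = 0] the factor [y * z] vanishes. Entering the orthant along [(s, h, 1)], where
    [y * z = h], still yields the vanishing of the value, though not of the derivative. *)
Lemma root_dominated_side c : root_dominated c -> let k := w + 2 in
  c 2%N 0%N 2%N = c 4%N 0%N 0%N + c 0%N 0%N 4%N - k * (c 3%N 0%N 1%N + k * c 4%N 0%N 0%N) /\
  c 1%N 0%N 3%N = c 3%N 0%N 1%N + k * c 4%N 0%N 0%N - k * c 0%N 0%N 4%N.
Proof.
move=> cF k.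
have root s : 0 < s -> s ^+ 2 + 1 = (w + 2) * s -> tform 4 c s 0 1 = 0.
  move=> s0 sw.
  have := @dominated_root _ (tform_line 5 cB s 0 1 0 1 0) (tform_line 4 c s 0 1 0 1 0) 1 ltr01.
  rewrite !horner_tform_line !mulr0 !addr0; apply.
    move=> h /andP[h0 h1]; rewrite !horner_tform_line !mul0r !mul1r !addr0 !add0r cBE.
    by have := cF s h 1; rewrite mulr1; apply => //; exact: ltW.
  by rewrite cBE B_value_sym12 B_zero_edge.
have := root u u0 uw; have := root v v0 vw; rewrite /tform !tformE /= => pv pu.
apply: (binary_quartic uv) => //; rewrite ?gt_eqF //.
- by rewrite -[RHS]pu; ring.
- by rewrite -[RHS]pv; ring.
Qed.

Lemma root_dominated_eq0 c : root_dominated c ->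
  forall i j k, (i + j + k = 4)%N -> c i j k = 0.
Proof.
move=> cF; have t2' := t2; have w0' := w0; have tw := B_slack_w t2 w0 V0.
have [e1 e2 e3 e4] := root_dominated_edge cF.
have [f1 f2] := root_dominated_side cF.
have [/= g1 g2] := root_dominated_side (root_dominated_perm23 cF).
(* [be] and [ga] are the middle coefficients of the quadratic cofactors on the sides [y = 0] and
   [z = 0]. *)
pose be := c 3%N 0%N 1%N + (w + 2) * c 4%N 0%N 0%N.
pose ga := c 3%N 1%N 0%N + (w + 2) * c 4%N 0%N 0%N.
have f3 : c 3%N 0%N 1%N = be - (w + 2) * c 4%N 0%N 0%N by rewrite /be; ring.
have g3 : c 3%N 1%N 0%N = ga - (w + 2) * c 4%N 0%N 0%N by rewrite /ga; ring.
rewrite -/be in f1 f2; rewrite -/ga in g1 g2.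
move: be ga f1 f2 f3 g1 g2 g3 => be ga f1 f2 f3 g1 g2 g3.
pose ee := (e1, e2, e3, e4, (f1, f2, f3), (g1, g2, g3)).
have i01 : -1 <= (0 : R) <= 1 by lra.
have i11 : -1 <= (1 : R) <= 1 by lra.
have i1N : -1 <= (-1 : R) <= 1 by lra.
have t1 : 1 <= t by lra.
have [va xa] := root_dominated_interior cF B_zero1 t1 (lexx 1) (lexx 1) i11 i01 i01.
have [_ ya] := root_dominated_interior cF B_zero1 t1 (lexx 1) (lexx 1) i01 i11 i1N.
have [vb xb] := root_dominated_interior cF B_zero2 (lexx 1) t1 (lexx 1) i11 i01 i01.
have [_ yb] := root_dominated_interior cF B_zero2 (lexx 1) t1 (lexx 1) i01 i11 i01.
have [_ zb] := root_dominated_interior cF B_zero2 (lexx 1) t1 (lexx 1) i01 i01 i11.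
have [vc _] := root_dominated_interior cF B_zero3 (lexx 1) (lexx 1) t1 i01 i01 i11.
have tm1 : t - 1 != 0 by rewrite subr_eq0 gt_eqF //; lra.
have t0 : t != 0 by rewrite gt_eqF //; lra.
(* By [tw], [(t + 1) w] is below [(t + 1) (t - 2) / 2], hence below [t ^ 2]. *)
have n1 : t ^+ 2 - t * w - w != 0 by rewrite gt_eqF //; nra.
have := det_neq0; rewrite mulf_eq0 negb_or => /andP[b1_n0 n2].
have bg : ga = be.
  have : bB1 t w * (t - 1) ^+ 2 * (be - ga) = 0.
    transitivity ((t - 1) * dtform 4 c t 1 1 0 1 (-1) - (tform 4 c 1 t 1 - tform 4 c 1 1 t)).
      by rewrite /dtform /tform !tformE /= !ee /bB1; ring.
    by rewrite ya vb vc; ring.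
  move/eqP; rewrite ?(mulf_eq0, expf_eq0, negbTE b1_n0, negbTE tm1) /= subr_eq0.
  by move/eqP.
have l23 : c 1%N 1%N 2%N = c 1%N 2%N 1%N.
  have : t * (c 1%N 2%N 1%N - c 1%N 1%N 2%N) = 0.
    by rewrite -[RHS]ya /dtform !tformE /= !ee bg; ring.
  by move/eqP; rewrite ?(mulf_eq0, expf_eq0, negbTE t0) /= subr_eq0 => /eqP.
(* Up to the swap-symmetry just obtained five unknowns remain; the multipliers are cofactors. *)
have k0 : c 0%N 0%N 4%N = 0.
  have : (t - 1) ^+ 3 * bB1 t w ^+ 2 * (t ^+ 2 + 4 * t - w) * c 0%N 0%N 4%N = 0.
    transitivity (
      (2 * t ^+ 4 - 3 * t ^+ 3 * w - 3 * t ^+ 3 - 5 * t ^+ 2 * w - 9 * t ^+ 2 + t * w + 4 * t + w)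
        * tform 4 c t 1 1
      + t * (t - 1) * (t + 2) * bB1 t w / 2 * dtform 4 c t 1 1 1 0 0
      - t ^+ 2 * (3 * t ^+ 3 - 2 * t ^+ 2 * w + 3 * t ^+ 2 - 8 * t * w - 24 * t + 4 * w + 12)
        * tform 4 c 1 t 1
      + t ^+ 2 * (t - 1) * (t ^+ 3 - t ^+ 2 * w + t ^+ 2 - 4 * t * w - 8 * t - w)
        * dtform 4 c 1 t 1 0 1 0
      + t ^+ 2 * (t - 1) * (t ^+ 2 + 4 * t - 3 * w - 8) * dtform 4 c 1 t 1 0 0 1).
      by rewrite /dtform /tform !tformE /= !ee bg l23 /bB1; field.
    by rewrite va xa vb yb zb; ring.
  move/eqP; rewrite ?(mulf_eq0, expf_eq0, negbTE b1_n0, negbTE tm1, negbTE n2) /=.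
  by move/eqP.
have al0 : c 4%N 0%N 0%N = 0.
  have : (t - 1) ^+ 2 * (t ^+ 2 - t * w - w) * (t ^+ 2 * w + 3 * t ^+ 2 + t * w + w) *
      c 4%N 0%N 0%N = 0.
    transitivity (
      - (t + 1) * (t * w + 5 * t - w - 2) * tform 4 c t 1 1
      + t * (t - 1) * (t + 1) * (w + 4) / 2 * dtform 4 c t 1 1 1 0 0
      - (t ^+ 3 + 3 * t ^+ 2 - 2 * t * w - 10 * t + 2 * w) * tform 4 c 1 t 1
      + (t - 1) * (t ^+ 2 + 4 * t - w) * dtform 4 c 1 t 1 1 0 0).
      by rewrite /dtform /tform !tformE /= !ee bg l23 k0; field.
    by rewrite va xa vb xb; ring.
  move/eqP; rewrite ?(mulf_eq0, expf_eq0, negbTE tm1, negbTE n1) /= => /orP[|/eqP//].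
  have tt : 0 < t ^+ 2 by apply: exprn_gt0; lra.
  have tw0 : 0 < t * w by apply: mulr_gt0 => //; lra.
  by rewrite gt_eqF //; have := mulr_gt0 tt w0; lra.
have be0 : be = 0.
  have : (t - 1) * (t + 1) * (t ^+ 2 - t * w - w) * be = 0.
    transitivity ((t - 1) * tform 4 c 1 t 1 + t * dtform 4 c 1 t 1 0 1 0
      - t * dtform 4 c 1 t 1 0 0 1).
      by rewrite /dtform /tform !tformE /= !ee bg l23 k0 al0; ring.
    by rewrite vb yb zb; ring.
  move/eqP; rewrite ?(mulf_eq0, expf_eq0, negbTE tm1, negbTE n1) /= => /orP[|/eqP//].
  by rewrite gt_eqF //; lra.
have l20 : c 1%N 2%N 1%N = 0.
  have : t * (t - 1) * (t + 2) * c 1%N 2%N 1%N = 0.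
    transitivity (t * tform 4 c 1 t 1 - tform 4 c t 1 1).
      by rewrite /tform !tformE /= !ee bg l23 k0 al0 be0; ring.
    by rewrite va vb; ring.
  move/eqP; rewrite ?(mulf_eq0, expf_eq0, negbTE tm1, negbTE t0) /= => /orP[|/eqP//].
  by rewrite gt_eqF //; lra.
have l10 : c 2%N 1%N 1%N = 0.
  have : t ^+ 2 * c 2%N 1%N 1%N = 0.
    by rewrite -[RHS]va /tform !tformE /= !ee bg l23 k0 al0 be0 l20; ring.
  by move/eqP; rewrite ?(mulf_eq0, expf_eq0, negbTE t0) /= => /eqP.
move=> i j k ijk; have : (i, j, k) \in expos 4 by rewrite mem_expos ijk.
rewrite expos4 !inE.
do ?[case/orP]; move=> /eqP[-> -> ->];
  by rewrite ?ee ?bg ?l23 ?k0 ?al0 ?be0 ?l20 ?l10 ?mulr0 ?subr0 ?addr0.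
Qed.
End Uniqueness.

(** * Ternary polynomials *)

Section TernaryPolynomials.
Variable R : realType.
Implicit Types f g : {mpoly R[3]}.

Definition monomial (i j k : nat) : {mpoly R[3]} := va R ^+ i * vb R ^+ j * vc R ^+ k.

Lemma mpolyX_monomial (m : 'X_{1..3}) : 'X_[m] = monomial (m 0%R) (m 1%R) (m 2%R).
Proof.
rewrite mpolyXE_id !big_ord_recr big_ord0 /= mul1r /monomial /va /vb /vc.
by congr ('X_ _ ^+ m _ * 'X_ _ ^+ m _ * 'X_ _ ^+ m _); apply: val_inj.
Qed.

Lemma mdeg3 (m : 'X_{1..3}) : mdeg m = (m 0%R + m 1%R + m 2%R)%N.
Proof.
rewrite mdegE !big_ord_recr big_ord0 /= add0n.
by congr (m _ + m _ + m _)%N; apply: val_inj.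
Qed.

Lemma monomialM i j k i' j' k' :
  monomial i j k * monomial i' j' k' = monomial (i + i') (j + j') (k + k').
Proof. by rewrite /monomial !exprD; ring. Qed.

Lemma monomial_homog i j k : monomial i j k \is (i + j + k).-homog.
Proof.
have X (x : 'I_3) e : ('X_x : {mpoly R[3]}) ^+ e \is e.-homog.
  by rewrite -{2}[e]mul1n; apply: dhomogMn; rewrite dhomogX /= mdeg1.
by rewrite /monomial !dhomogM // X.
Qed.

Lemma tform_monomial d (c : nat -> nat -> nat -> R) :
  tform d (fun i j k => (c i j k)%:MP) (va R) (vb R) (vc R) =
  \sum_(m <- expos d) c m.1.1 m.1.2 m.2 *: monomial m.1.1 m.1.2 m.2.
Proof. by apply: eq_bigr => m _; rewrite mul_mpolyC. Qed.

Lemma homog_tform d f : f \is d.-homog ->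
  exists c, f = tform d (fun i j k => (c i j k)%:MP) (va R) (vb R) (vc R).
Proof.
move=> /dhomogP fd; rewrite (mpolyE f) big_seq_cond.
apply: (big_ind (fun g => exists c,
  g = tform d (fun i j k => (c i j k)%:MP) (va R) (vb R) (vc R))).
- exists (fun _ _ _ => 0); rewrite tform_monomial big1 // => m _.
  by rewrite scale0r.
- move=> _ _ [c1 ->] [c2 ->]; exists (fun i j k => c1 i j k + c2 i j k).
  by rewrite !tform_monomial -big_split; apply: eq_bigr => m _; rewrite scalerDl.
move=> m /andP[/fd md _]; have {md} : mdeg m = _ := md; rewrite mdeg3 => md.
exists (fun i j k => f@_m *+ ((i, j, k) == (m 0%R, m 1%R, m 2%R))).
rewrite tform_monomial (bigD1_seq (m 0%R, m 1%R, m 2%R)) ?expos_uniq ?mem_expos ?md //=.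
rewrite eqxx mpolyX_monomial big1 ?addr0 // => -[[i j] k] /negbTE /= ->.
by rewrite mulr0n scale0r.
Qed.

Definition pt (x y z : R) : 'I_3 -> R := fun i => [:: x; y; z]`_i.

Lemma meval_tform d c (v : 'I_3 -> R) :
  (tform d (fun i j k => (c i j k)%:MP) (va R) (vb R) (vc R)).@[v] =
  tform d c (v 0) (v 1) (v 2).
Proof.
rewrite tform_rmorph /va /vb /vc /= !mevalXU.
by apply: eq_bigr => m _; rewrite mevalC.
Qed.

Lemma tform_eq0 d (c : nat -> nat -> nat -> R) :
  (forall i j k, (i + j + k)%N = d -> c i j k = 0) ->
  tform d (fun i j k => (c i j k)%:MP) (va R) (vb R) (vc R) = 0.
Proof.
move=> c0; rewrite tform_monomial big_seq big1 // => -[[i j] k].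
by rewrite mem_expos => /eqP /c0 /= ->; rewrite scale0r.
Qed.

Lemma meval_pt f v : f.@[v] = f.@[pt (v 0) (v 1) (v 2)].
Proof.
apply: meval_eq => -[[|[|[|//]]] i3]; rewrite /pt /=;
  by congr v; apply: val_inj.
Qed.

Lemma sq_substD f g : sq_subst (f + g) = sq_subst f + sq_subst g.
Proof. exact: rmorphD. Qed.

Lemma sq_substZ (l : R) f : sq_subst (l *: f) = l *: sq_subst f.
Proof. exact: comp_mpolyZ. Qed.

Lemma sq_subst0 : sq_subst (0 : {mpoly R[3]}) = 0.
Proof. exact: rmorph0. Qed.

Lemma sq_subst_monomial i j k : sq_subst (monomial i j k) = monomial (i.*2) (j.*2) (k.*2).
Proof.
have X (x : 'I_3) : sq_subst ('X_x : {mpoly R[3]}) = 'X_x ^+ 2.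
  by rewrite /sq_subst comp_mpolyXU -tnth_nth tnth_mktuple.
by rewrite /monomial /sq_subst !rmorphM !rmorphXn /= -!/(sq_subst _) !X -!exprM !mul2n.
Qed.

Lemma meval_sq_subst f x y z :
  (sq_subst f).@[pt x y z] = f.@[pt (x ^+ 2) (y ^+ 2) (z ^+ 2)].
Proof.
rewrite /sq_subst comp_mpoly_meval; apply: meval_eq => i.
rewrite tnth_mktuple rmorphXn /= mevalXU.
by case: i => [[|[|[|//]]] i3]; rewrite /pt.
Qed.

Lemma sq_subst_homog d f : f \is d.-homog -> sq_subst f \is (d.*2).-homog.
Proof.
move=> /homog_tform[c ->]; rewrite tform_monomial /sq_subst raddf_sum /= big_seq.
apply: rpred_sum => -[[i j] k]; rewrite mem_expos => /eqP <- /=.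
rewrite -/(sq_subst _) sq_substZ sq_subst_monomial !doubleD.
by apply: rpredZ; exact: monomial_homog.
Qed.

(** In even total degree the number of odd exponents is 0 or 2, which leaves four parity classes. *)
Lemma homog_parity d f : f \is ((d.+1).*2).-homog ->
  exists g0 g1 g2 g3 : {mpoly R[3]},
  [/\ g0 \is (d.+1).-homog, g1 \is d.-homog, g2 \is d.-homog, g3 \is d.-homog &
    f = sq_subst g0 + monomial 0 1 1 * sq_subst g1 + monomial 1 0 1 * sq_subst g2 +
        monomial 1 1 0 * sq_subst g3].
Proof.
move=> /dhomogP fd; rewrite (mpolyE f) big_seq_cond.
apply: (big_ind (fun f' => exists g0 g1 g2 g3 : {mpoly R[3]},
  [/\ g0 \is (d.+1).-homog, g1 \is d.-homog, g2 \is d.-homog, g3 \is d.-homog &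
    f' = sq_subst g0 + monomial 0 1 1 * sq_subst g1 + monomial 1 0 1 * sq_subst g2 +
        monomial 1 1 0 * sq_subst g3])).
- by exists 0, 0, 0, 0; rewrite !dhomog0 sq_subst0 !mulr0 !addr0.
- move=> _ _ [g0 [g1 [g2 [g3 [h0 h1 h2 h3 ->]]]]] [k0 [k1 [k2 [k3 [l0 l1 l2 l3 ->]]]]].
  exists (g0 + k0), (g1 + k1), (g2 + k2), (g3 + k3); rewrite !rpredD // !sq_substD.
  by split=> //; ring.
move=> m /andP[/fd md _]; have {md} : mdeg m = _ := md; rewrite mdeg3 mpolyX_monomial.
move: (m 0%R) (m 1%R) (m 2%R) (f@_m) => i j k a.
rewrite -[i]odd_double_half -[j]odd_double_half -[k]odd_double_half.
move: (odd i) (odd j) (odd k) i./2 j./2 k./2 => p q r {}i {}j {}k.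
have Z e l (g : {mpoly R[3]}) : g \is e.-homog -> l *: g \is e.-homog by exact: rpredZ.
have M e i' j' k' : (i' + j' + k')%N = e -> monomial i' j' k' \is e.-homog.
  by move=> <-; exact: monomial_homog.
case: p q r => [] [] []; rewrite /= ?add0n ?add1n => ijk; try lia.
- exists 0, 0, 0, (a *: monomial i j k); rewrite !dhomog0 Z ?M //; last by lia.
  rewrite sq_substZ sq_subst_monomial sq_subst0 !mulr0 !add0r -scalerAr monomialM.
  by split.
- exists 0, 0, (a *: monomial i j k), 0; rewrite !dhomog0 Z ?M //; last by lia.
  rewrite sq_substZ sq_subst_monomial sq_subst0 !mulr0 !add0r !addr0 -scalerAr monomialM.
  by split.
- exists 0, (a *: monomial i j k), 0, 0; rewrite !dhomog0 Z ?M //; last by lia.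
  rewrite sq_substZ sq_subst_monomial sq_subst0 !mulr0 !add0r !addr0 -scalerAr monomialM.
  by split.
exists (a *: monomial i j k), 0, 0, 0; rewrite !dhomog0 Z ?M //; last by lia.
rewrite sq_substZ sq_subst_monomial sq_subst0 !mulr0 !addr0.
by split.
Qed.

Lemma eB_homog (t u : R) : eB t u \is 5.-homog.
Proof.
have X (x : 'I_3) e : ('X_x : {mpoly R[3]}) ^+ e \is e.-homog.
  by rewrite -{2}[e]mul1n; apply: dhomogMn; rewrite dhomogX /= mdeg1.
have S m n : Smn R m n \is (m + n).-homog by rewrite /Smn !rpredD // dhomogM // X.
have U3 : U R \is 3.-homog by exact: (monomial_homog 1 1 1).
have US : U R * Smn R 1 1 \is 5.-homog by exact: dhomogM U3 (S 1%N 1%N).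
have T m n : (m + n = 5)%N -> Tmn R m n \is 5.-homog.
  by move=> mn; rewrite rpredD // -mn ?S // addnC S.
have h0 : s0 R \is 5.-homog by apply: rpredB => //; exact: (S 5%N 0%N).
have h1 : s1 R \is 5.-homog by apply: rpredB; [exact: T | exact: rpredZ].
have h2 : s2 R \is 5.-homog by apply: rpredB; [exact: T | exact: rpredZ].
have h3 : s3 R \is 5.-homog by apply: rpredB => //; exact: dhomogM U3 (S 2%N 0%N).
rewrite /eB; apply: rpredD; last by apply: rpredZ; exact: US.
apply: rpredD; last exact: rpredZ.
apply: rpredD; last exact: rpredZ.
by apply: rpredD; last exact: rpredZ.
Qed.
End TernaryPolynomials.

(** * Extremality *)

Section Extremality.
Variables (R : realType) (t u : R).
Hypotheses (t2 : 2 <= t) (uB : muB t <= u) (u1 : u < 1) (b1_neq0 : bB1 t (omega u) != 0).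
Local Notation F := (B_value t (omega u)).
Local Notation f := (eB t u).

Lemma edge_params : [/\ 2 < t, 0 < omega u, 0 <= B_slack t (omega u) &
  [/\ 0 < u, 0 < u^-1, u != u^-1, u ^+ 2 + 1 = (omega u + 2) * u &
      (u^-1) ^+ 2 + 1 = (omega u + 2) * u^-1]].
Proof.
have [h1 h2 h3 h4] := parameter_region t2 uB u1.
have iu : 1 < u^-1 by rewrite invf_gt1.
have iu0 : 0 < u^-1 by rewrite invr_gt0.
split=> //; split=> //.
- by rewrite lt_eqF // (lt_trans u1 iu).
- by rewrite omega_edge // gt_eqF.
- by rewrite -[omega u]omegaV omega_edge // gt_eqF.
Qed.

Lemma meval_eB_pt x y z : f.@[pt x y z] = F x y z.
Proof. by rewrite meval_eB. Qed.

Lemma eB_form : exists c, forall x y z, tform 5 c x y z = F x y z.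
Proof.
have [c fE] := homog_tform (eB_homog t u); exists c => x y z.
by rewrite -meval_eB_pt fE meval_tform.
Qed.

Lemma eB_ge0 x y z : 0 <= x -> 0 <= y -> 0 <= z -> 0 <= F x y z.
Proof. by have [h1 _ h2 _] := edge_params; exact: B_value_ge0. Qed.

Lemma eB_100 : F 1 0 0 = 1.
Proof. by rewrite /B_value; ring. Qed.

(** As [F 1 0 0 = 1], subtracting [l *: f] kills the corner coefficient [c 5 0 0]. The difference is
    dominated with constant [1 + |l|], so [dominated_eq0] applies. *)
Lemma eB_unique g : g \is 5.-homog ->
  (forall x y z, 0 <= x -> 0 <= y -> 0 <= z -> 0 <= g.@[pt x y z] <= F x y z) ->
  g = g.@[pt 1 0 0] *: f.
Proof.
move=> gh gF; pose l := g.@[pt 1 0 0].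
have [h1 h2 h3 [k1 k2 k3 k4 k5]] := edge_params.
have [cB cBE] := eB_form.
have gf5 : g - l *: f \is 5.-homog by rewrite rpredB // rpredZ // eB_homog.
have [c gE] := homog_tform gf5.
have cE x y z : tform 5 c x y z = g.@[pt x y z] - l * F x y z.
  by rewrite -meval_eB_pt -mevalZ -mevalB gE meval_tform.
have cF : B_dominated t (omega u) c.
  exists (1 + `|l|) => x y z x0 y0 z0; rewrite cE.
  have /andP[g0 g1] := gF x y z x0 y0 z0.
  have F0 := eB_ge0 x0 y0 z0.
  rewrite mulrDl mul1r; apply: le_trans (ler_normB _ _) _.
  by rewrite normrM (ger0_norm g0) (ger0_norm F0) lerD2r.
have c500 : c 5%N 0%N 0%N = 0.
  have := cE 1 0 0; rewrite eB_100 mulr1 subrr => <-.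
  by rewrite /tform !tformE /=; ring.
apply/eqP; rewrite -subr_eq0 gE tform_eq0 //.
exact: (dominated_eq0 h1 h2 h3 b1_neq0 k1 k2 k3 k4 k5 cBE cF c500).
Qed.

Lemma eB_quartic_eq0 (c : nat -> nat -> nat -> R) :
  (forall x y z, 0 <= x -> 0 <= y -> 0 <= z -> y * z * tform 4 c x y z ^+ 2 <= F x y z ^+ 2) ->
  forall i j k, (i + j + k = 4)%N -> c i j k = 0.
Proof.
have [h1 h2 h3 [k1 k2 k3 k4 k5]] := edge_params; have [cB cBE] := eB_form => cF.
exact: (root_dominated_eq0 h1 h2 h3 b1_neq0 k1 k2 k3 k4 k5 cBE cF).
Qed.

Lemma eB_sq_unique g : g \is 10.-homog ->
  (forall x y z, 0 <= g.@[pt x y z] <= F (x ^+ 2) (y ^+ 2) (z ^+ 2)) ->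
  g = g.@[pt 1 0 0] *: sq_subst f.
Proof.
move=> gh gF; have [g0 [g1 [g2 [g3 [d0 d1 d2 d3 gE]]]]] := @homog_parity R 4 g gh.
have [c1 E1] := homog_tform d1; have [c2 E2] := homog_tform d2; have [c3 E3] := homog_tform d3.
pose K c (x y z : R) := tform 4 c (x ^+ 2) (y ^+ 2) (z ^+ 2).
have vE x y z : g.@[pt x y z] = g0.@[pt (x ^+ 2) (y ^+ 2) (z ^+ 2)] +
    y * z * K c1 x y z + x * z * K c2 x y z + x * y * K c3 x y z.
  rewrite gE !(mevalD, mevalM) !meval_sq_subst E1 E2 E3 !meval_tform.
  by rewrite /monomial !(mevalM, rmorphXn) /= !mevalXU /K /pt /=; ring.
have KN c x y z : (K c (- x) y z = K c x y z) * (K c x (- y) z = K c x y z) *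
    (K c x y (- z) = K c x y z) by rewrite /K !sqrrN.
(* Averaging over sign changes of the variables isolates the parity classes of [g]. *)
have bounds x y z : [/\ 0 <= g0.@[pt (x ^+ 2) (y ^+ 2) (z ^+ 2)] <= F (x ^+ 2) (y ^+ 2) (z ^+ 2),
    `|y * z * K c1 x y z| <= F (x ^+ 2) (y ^+ 2) (z ^+ 2),
    `|x * z * K c2 x y z| <= F (x ^+ 2) (y ^+ 2) (z ^+ 2) &
    `|x * y * K c3 x y z| <= F (x ^+ 2) (y ^+ 2) (z ^+ 2)].
  have := (gF x y z, gF (- x) y z, gF x (- y) z, gF x y (- z)).
  rewrite !vE !KN !sqrrN => -[[[/andP[p1 p2] /andP[p3 p4]] /andP[p5 p6]] /andP[p7 p8]].
  by split; rewrite ?ler_norml; apply/andP; split; lra.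
have sq (x : R) : 0 <= x -> x = Num.sqrt x ^+ 2 by move=> x0; rewrite sqr_sqrtr.
have sqnorm (a b : R) : `|a| <= b -> a ^+ 2 <= b ^+ 2.
  move=> ab; rewrite -(real_normK (num_real a)) ler_pXn2r // nnegrE ?normr_ge0 //.
  exact: le_trans ab.
have z1 : g1 = 0.
  rewrite E1 tform_eq0 //; apply: eB_quartic_eq0 => x y z x0 y0 z0.
  have [_ /sqnorm b _ _] := bounds (Num.sqrt x) (Num.sqrt y) (Num.sqrt z).
  by move: b; rewrite !exprMn /K -!sq.
(* By the symmetry of [F], a swap of variables turns the factor [x * z], and below [x * y], into the
   [y * z] of [eB_quartic_eq0]. *)
have z2 : g2 = 0.
  rewrite E2 tform_eq0 // => i j k ijk.
  apply: (@eB_quartic_eq0 (fun i j k => c2 j i k)); last by rewrite [(j + i)%N]addnC.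
  move=> x y z x0 y0 z0.
  have [_ _ /sqnorm b _] := bounds (Num.sqrt y) (Num.sqrt x) (Num.sqrt z).
  move: b; rewrite !exprMn /K -!sq // [F y x z]B_value_sym12.
  by congr (_ * _ ^+ 2 <= _); rewrite /tform !tformE /=; ring.
have z3 : g3 = 0.
  rewrite E3 tform_eq0 // => i j k ijk.
  apply: (@eB_quartic_eq0 (fun i j k => c3 k j i)); last by lia.
  move=> x y z x0 y0 z0.
  have [_ _ _ /sqnorm b] := bounds (Num.sqrt z) (Num.sqrt y) (Num.sqrt x).
  move: b; rewrite !exprMn /K -!sq // [F z y x]B_value_sym12 B_value_sym23 B_value_sym12.
  rewrite [z * y]mulrC.
  by congr (_ * _ ^+ 2 <= _); rewrite /tform !tformE /=; ring.
have g0E : g0 = g0.@[pt 1 0 0] *: f.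
  apply: eB_unique => // x y z x0 y0 z0.
  have [] := bounds (Num.sqrt x) (Num.sqrt y) (Num.sqrt z).
  by rewrite -!sq.
rewrite vE; rewrite {1}gE z1 z2 z3 sq_subst0 !mulr0 !addr0 !mul0r !addr0 expr1n expr0n /=.
by rewrite {1}g0E sq_substZ.
Qed.
End Extremality.
Unset Implicit Arguments.
Set Strict Implicit.

Theorem theorem4p28 (R : realType) (t u : R) :
  2 <= t -> muB t <= u -> u < 1 -> bB1 t (omega u) != 0 ->
  extremal (@Pplus35 R) (eB t u) /\ extremal (@P310 R) (sq_subst (eB t u)).
Proof.
move=> t2 uB u1 b1.
have pt0 (x y z : R) : 0 <= x -> 0 <= y -> 0 <= z -> forall i, 0 <= pt x y z i.
  by move=> x0 y0 z0 [[|[|[|//]]] ?].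
split; split; [split | split | split | split].
- exact: eB_homog.
- by move=> x x0; rewrite meval_eB; apply: eB_ge0.
- apply: contra_eq_neq (eB_100 t u) => f0.
  by rewrite -meval_eB_pt f0 meval0 eq_sym oner_neq0.
- move=> g h [gh g0] [hh h0] fE.
  (* A summand lies between 0 and [F] on the orthant, and its multiplier is its own value at
     [(1, 0, 0)], hence nonnegative. *)
  have P k l : k \is 5.-homog -> (forall x, (forall i, 0 <= x i) -> 0 <= k.@[x]) ->
      (forall x, (forall i, 0 <= x i) -> 0 <= l.@[x]) -> eB t u = k + l ->
      exists2 m, 0 <= m & k = m *: eB t u.
    move=> kh k0 l0 kl; exists k.@[pt 1 0 0]; first by apply/k0/pt0.
    apply: (eB_unique t2 uB u1 b1 kh) => x y z x0 y0 z0.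
    rewrite -meval_eB_pt kl mevalD lerDl k0 ?l0 //; exact: pt0.
  by split; [exact: (P g h) | apply: (P h g) => //; rewrite addrC].
- exact: (sq_subst_homog (eB_homog t u)).
- move=> x; rewrite meval_pt meval_sq_subst meval_eB_pt.
  by apply: eB_ge0 => //; exact: sqr_ge0.
- apply: contra_eq_neq (eB_100 t u) => f0.
  have := meval_sq_subst (eB t u) 1 0 0.
  rewrite f0 meval0 meval_eB_pt expr1n expr0n /= => <-.
  by rewrite eq_sym oner_neq0.
move=> g h [gh g0] [hh h0] fE.
have P k l : k \is 10.-homog -> (forall x, 0 <= k.@[x]) -> (forall x, 0 <= l.@[x]) ->
    sq_subst (eB t u) = k + l -> exists2 m, 0 <= m & k = m *: sq_subst (eB t u).
  move=> kh k0 l0 kl; exists k.@[pt 1 0 0] => //.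
  apply: (eB_sq_unique t2 uB u1 b1 kh) => x y z.
  by rewrite -meval_eB_pt -meval_sq_subst kl mevalD lerDl k0 l0.
by split; [exact: (P g h) | apply: (P h g) => //; rewrite addrC].
Qed.
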